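(* Let $G$ be a topological group and let $(X,d)$ be a metric space endowed with a continuous action of $G$, with the following properties. (1) For each $g\in G$, the homeomorphism $X\to X$, $x\mapsto gx$, is boundedness preserving and uniformly continuous on bounded sets. (2) The topology of $G$ contains the topology of uniform convergence on bounded sets. Then the induced action $G\times\mathrm{CL}(X)\to\mathrm{CL}(X)$, $(g,A)\mapsto gA=\{ga: a\in A\}$, is continuous, where $\mathrm{CL}(X)$ is equipped with the Attouch-Wets metric topology.
   Context: $\mathrm{CL}(X)$ denotes the family of all nonempty closed subsets of $X$. The Attouch-Wets metric on $\mathrm{CL}(X)$ based at a fixed point $x_0\in X$ is $$d_{AW}(A,B)=\sup_{j\in\mathbb N}\ \min\Big\{\tfrac1j,\ \sup_{d(x_0,x)<j}|d(x,A)-d(x,B)|\Big\},$$ where $\mathbb N=\{1,2,\dots\}$ and $d(x,A)=\inf_{a\in A}d(x,a)$; the topology it generates (the Attouch-Wets metric topology) does not depend on $x_0$. A map $f:X\to X$ is boundedness preserving if $f(A)$ is bounded for every bounded $A\subset X$. It is uniformly continuous on bounded sets if for every bounded $A\subset X$ and every $\varepsilon>0$ there is $\delta>0$ such that $a\in A$, $x\in X$ and $d(a,x)<\delta$ imply $d(f(a),f(x))<\varepsilon$. The topology of uniform convergence on bounded sets on $G$ is the topology generated by all sets $(A,g,\varepsilon)=\{h\in G: d(gx,hx)<\varepsilon\ \text{for all } x\in A\}$, where $A\subset X$ is bounded, $g\in G$ and $\varepsilon>0$. *)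

(* Defs.v *)
From HB Require Import structures.
From mathcomp Require Import all_boot all_order all_algebra.
From mathcomp Require Import all_classical all_reals topology.

Set Implicit Arguments.
Unset Strict Implicit.
Unset Printing Implicit Defensive.

Import Order.TTheory GRing.Theory Num.Theory.

Local Open Scope classical_set_scope.
Local Open Scope ring_scope.

(* No separation axiom is imposed on topological groups. *)
HB.mixin Record TopologicalGroup_axioms G & Topological G & Group G := {
  mulg_continuous : continuous (fun p : G * G => (p.1 * p.2)%g) ;
  invg_continuous : continuous (fun g : G => (g^-1)%g) ;
}.

#[short(type="topologicalGroupType")]
HB.structure Definition TopologicalGroup :=
  { G of Topological G & Group G & TopologicalGroup_axioms G }.

Record continuous_action (G : topologicalGroupType) (X : topologicalType) :=
  ContinuousAction {
    act :> G -> X -> X ;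
    act1 : forall x, act 1%g x = x ;
    actM : forall g h x, act (g * h)%g x = act g (act h x) ;
    act_continuous : continuous (fun p : G * X => act p.1 p.2)
  }.

Section metric_notions.
Context {R : realType} {X : metricType R}.

(* Finite diameter, so that [set0] is bounded even when [X] is empty. *)
Definition mbounded (A : set X) : Prop :=
  exists r : R, forall x y, A x -> A y -> mdist x y <= r.

Definition boundedness_preserving (f : X -> X) : Prop :=
  forall A, mbounded A -> mbounded (f @` A).

Definition unif_continuous_on_bounded (f : X -> X) : Prop :=
  forall A, mbounded A -> forall e : R, 0 < e ->
    exists2 d : R, 0 < d &
      forall a x, A a -> mdist a x < d -> mdist (f a) (f x) < e.

Definition infdist (x : X) (A : set X) : R := inf [set mdist x a | a in A].

End metric_notions.

Section bounded_convergence.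
Context {R : realType} {G : topologicalGroupType} {X : metricType R}.
Variable a : continuous_action G X.

Definition ucb_set (A : set X) (g : G) (e : R) : set G :=
  [set h | forall x, A x -> mdist (a g x) (a h x) < e].

Definition ucb_subbase : set (set G) :=
  [set U | exists A g e, [/\ mbounded A, 0 < e & U = ucb_set A g e]].

(* A copy of [G] whose own topology is replaced by the one generated by
   [ucb_subbase]. *)
Definition ucb_space of continuous_action G X : Type := G.

HB.instance Definition _ := Choice.copy (ucb_space a) G.
HB.instance Definition _ :=
  @isSubBaseTopological.Build (ucb_space a) (set G) ucb_subbase id.

End bounded_convergence.

Section hyperspace.
Context {R : realType}.
Implicit Types X : metricType R.

Record CL X := MkCL {
  CL_set :> set X ;
  CL_closed : closed CL_set ;
  CL_nonempty : CL_set !=set0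
}.

Lemma CL_inj X (A B : CL X) : CL_set A = CL_set B -> A = B.
Proof.
case: A B => [A Ac A0] [B Bc B0] /= AB; move: Ac A0; rewrite AB => Ac A0.
by congr MkCL; exact: Prop_irrelevance.
Qed.

Definition dAW X (x0 : X) (A B : set X) : R :=
  sup [set Num.min j%:R^-1
             (sup [set `|infdist x A - infdist x B| |
                   x in [set x | mdist x0 x < j%:R]])
      | j in [set j : nat | (0 < j)%N]].

Section infdist_theory.
Variable X : metricType R.
Implicit Types (A B : CL X) (x y : X).

Let infdist_lb (A : set X) x : has_lbound [set mdist x a | a in A].
Proof. by exists 0 => _ [a _ <-]; exact: mdist_ge0. Qed.

Lemma infdist_le (A : set X) x a : A a -> infdist x A <= mdist x a.
Proof. by move=> Aa; apply: ge_inf; [exact: infdist_lb|exists a]. Qed.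

Lemma infdist_ge0 A x : 0 <= infdist x A.
Proof.
apply: lb_le_inf; first by have [a Aa] := CL_nonempty A; exists (mdist x a), a.
by move=> _ [a _ <-]; exact: mdist_ge0.
Qed.

Lemma infdist_lip A x y : infdist x A <= mdist x y + infdist y A.
Proof.
rewrite -lerBlDl; apply: lb_le_inf.
  by have [a Aa] := CL_nonempty A; exists (mdist y a), a.
move=> _ [a Aa <-]; rewrite lerBlDl.
exact: le_trans (infdist_le x Aa) (metric_triangle _ _ _).
Qed.

Lemma infdist0 A x : infdist x A = 0 -> CL_set A x.
Proof.
move=> dA; apply: (@CL_closed _ A) => U /nbhs_ballP[e /= e0 eU].
have [|_ [a Aa <-]] := @inf_adherent R [set mdist x a | a in A] e e0.
  by split; [have [a Aa] := CL_nonempty A; exists (mdist x a), a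
            |exact: infdist_lb].
rewrite -/(infdist x A) dA add0r => xae; exists a; split => //.
by apply: eU; rewrite ballEmdist.
Qed.

Lemma infdist_mem A x : CL_set A x -> infdist x A = 0.
Proof.
move=> Ax; apply/eqP; rewrite eq_le infdist_ge0 andbT.
by rewrite -(mdistxx x) infdist_le.
Qed.

End infdist_theory.

Section dAW_theory.
Variables (X : metricType R) (x0 : X).
Implicit Types A B C : CL X.

Let gaps A B (j : nat) : set R :=
  [set `|infdist x A - infdist x B| | x in [set x | mdist x0 x < j%:R]].

Let gaps_ub A B j : has_ubound (gaps A B j).
Proof.
exists (j%:R + infdist x0 A + (j%:R + infdist x0 B)) => _ [x /= xj <-].
have le_inf C : infdist x C <= j%:R + infdist x0 C.
  by apply: le_trans (infdist_lip C x x0) _; rewrite lerD2r metric_sym ltW.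
apply: le_trans (ler_normB _ _) _.
by rewrite !ger0_norm ?infdist_ge0 // lerD.
Qed.

Let gaps0 A B j : (0 < j)%N -> gaps A B j !=set0.
Proof.
by move=> j0; exists `|infdist x0 A - infdist x0 B|, x0; rewrite //= mdistxx ltr0n.
Qed.

Let term A B (j : nat) : R := Num.min j%:R^-1 (sup (gaps A B j)).

Let term_ge0 A B j : (0 < j)%N -> 0 <= term A B j.
Proof.
move=> j0; rewrite /term le_min invr_ge0 ler0n /=.
have [r gr] := gaps0 A B j0.
apply: le_trans (ub_le_sup (gaps_ub A B j) gr).
by case: gr => x _ <-.
Qed.

Let terms A B : set R := [set term A B j | j in [set j : nat | (0 < j)%N]].

Let terms_ub A B : has_ubound (terms A B).
Proof.
exists 1 => _ [j /= j0 <-]; rewrite /term ge_min invf_le1 ?ltr0n //.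
by rewrite ler1n j0.
Qed.

Let terms0 A B : terms A B !=set0.
Proof. by exists (term A B 1), 1%N. Qed.

Let le_dAW A B j : (0 < j)%N -> term A B j <= dAW x0 A B.
Proof. by move=> j0; apply: (ub_le_sup (terms_ub A B)); exists j. Qed.

Lemma dAWxx A : dAW x0 A A = 0.
Proof.
have j1 : (0 < 1)%N by [].
apply/eqP; rewrite eq_le (le_trans (term_ge0 A A j1) (le_dAW A A j1)) andbT.
apply: (ge_sup (terms0 A A)) => _ [j /= j0 <-].
rewrite /term ge_min; apply/orP; right; apply: (ge_sup (gaps0 A A j0)).
by move=> _ [x _ <-]; rewrite subrr normr0.
Qed.

Lemma dAW_sym A B : dAW x0 A B = dAW x0 B A.
Proof.
rewrite /dAW; congr sup; apply: eq_imagel => j _; congr (Num.min _ (sup _)).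
by apply: eq_imagel => x _; rewrite distrC.
Qed.

Lemma dAW_triangle B A C : dAW x0 A C <= dAW x0 A B + dAW x0 B C.
Proof.
apply: (ge_sup (terms0 A C)) => _ [j /= j0 <-].
apply: le_trans (lerD (le_dAW A B j0) (le_dAW B C j0)).
have gap_le (D E : CL X) x : mdist x0 x < j%:R ->
    `|infdist x D - infdist x E| <= sup (gaps D E j).
  by move=> xj; apply: (ub_le_sup (gaps_ub D E j)); exists x.
have tAC : sup (gaps A C j) <= sup (gaps A B j) + sup (gaps B C j).
  apply: (ge_sup (gaps0 A C j0)) => _ [x /= xj <-].
  by apply: le_trans (ler_distD (infdist x B) _ _) _; rewrite lerD ?gap_le.
have := term_ge0 A B j0; have := term_ge0 B C j0; rewrite /term.
set u := sup (gaps A B j) in tAC *; set v := sup (gaps B C j) in tAC *.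
case: (leP j%:R^-1 v) => _; case: (leP j%:R^-1 u) => _ v0 u0; rewrite ge_min.
- by rewrite lerDl v0.
- by rewrite lerDr u0.
- by rewrite lerDl v0.
- by rewrite tAC orbT.
Qed.

Lemma dAW_positivity A B : dAW x0 A B = 0 -> A = B.
Proof.
move=> dAB; have eqd x : infdist x A = infdist x B.
  pose j := (Num.truncn (mdist x0 x)).+1.
  have xj : mdist x0 x < j%:R by exact: truncnS_gt.
  have : term A B j <= 0 by rewrite -dAB le_dAW.
  rewrite /term ge_min invr_le0 lern0 /= => gap0.
  apply/eqP; rewrite -subr_eq0 -normr_eq0 eq_le normr_ge0 andbT.
  by apply: le_trans gap0; apply: (ub_le_sup (gaps_ub A B j)); exists x.
apply: CL_inj; apply/seteqP; split => x /infdist_mem.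
  by rewrite eqd => /infdist0.
by rewrite -eqd => /infdist0.
Qed.

End dAW_theory.

Definition CL_AW X (x0 : X) : Type := CL X.

HB.instance Definition _ X (x0 : X) := gen_eqMixin (CL_AW x0).
HB.instance Definition _ X (x0 : X) := gen_choiceMixin (CL_AW x0).
HB.instance Definition _ X (x0 : X) :=
  @isMetric.Build R (CL_AW x0) (fun A B => dAW x0 (CL_set A) (CL_set B))
    (@dAWxx X x0) (@dAW_positivity X x0) (@dAW_sym X x0) (@dAW_triangle X x0).

End hyperspace.

Section induced_action.
Context {R : realType} {G : topologicalGroupType} {X : metricType R}.
Variable a : continuous_action G X.

Lemma act_image_closed (g : G) (A : set X) : closed A -> closed (a g @` A).
Proof.
have -> : a g @` A = a (g^-1)%g @^-1` A.
  apply/seteqP; split => [_ [x Ax <-]|x Ax] /=.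
    by rewrite -actM mulVg act1.
  by exists (a (g^-1)%g x); rewrite // -actM mulgV act1.
apply: preimage_closed => x _.
apply: (@continuous_comp _ _ _ (fun y : X => ((g^-1)%g, y)) (fun p => a p.1 p.2)).
  by apply: cvg_pair; [exact: cvg_cst|exact: cvg_id].
exact: act_continuous.
Qed.

Definition CL_act (g : G) (A : CL X) : CL X :=
  MkCL (act_image_closed (g := g) (@CL_closed R X A))
       (image_nonempty (a g) (@CL_nonempty R X A)).

End induced_action.

(* Main.v *)
(* Fix (g0, A) and let (g, B) be close to it.  Points of g0 A or g B at bounded
   distance from x0 come from a single bounded set K: for g0 A because g0^-1
   preserves boundedness, and for g B because inversion in G is continuous, so
   that g^-1 is uniformly close to g0^-1 on a ball around x0.  Attouch-Wets
   closeness matches the points of A and B in K, uniform continuity of g0 on K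
   carries the matching over to g0 A and g0 B, and g is uniformly close to g0
   on a neighbourhood of K. *)
Require Import Defs.
From mathcomp Require Import all_boot all_order all_algebra.
From mathcomp Require Import all_classical all_reals topology.
From mathcomp Require Import lra.

Set Implicit Arguments.
Unset Strict Implicit.
Unset Printing Implicit Defensive.

Import Order.TTheory GRing.Theory Num.Theory.

Local Open Scope classical_set_scope.
Local Open Scope ring_scope.

Section bounded_sets.
Context {R : realType} {X : metricType R}.
Implicit Types (x y : X) (A : set X) (r e : R).

Definition thickening A e : set X := [set y | exists2 x, A x & mdist x y < e].

Lemma mbounded_ball x r : mbounded [set y | mdist x y < r].
Proof.
exists (r + r) => y z /= xy xz.
apply: le_trans (metric_triangle _ x _) _.
by rewrite (metric_sym y x) lerD ?ltW.
Qed.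

Lemma mbounded_thickening A e : mbounded A -> mbounded (thickening A e).
Proof.
move=> [r Ar]; exists (e + (r + e)) => y z [y' Ay' y'y] [z' Az' z'z].
apply: le_trans (metric_triangle _ y' _) _.
rewrite (metric_sym y y') lerD ?(ltW y'y) //.
apply: le_trans (metric_triangle _ z' _) _.
by rewrite lerD ?Ar ?ltW.
Qed.

Lemma mbounded_sub_ball x A : mbounded A ->
  exists2 n : nat, (0 < n)%N & forall y, A y -> mdist x y < n%:R.
Proof.
move=> [r Ar]; have [[z Az]|A0] := pselect (A !=set0); last first.
  by exists 1%N => // y Ay; case: A0; exists y.
exists (Num.truncn (mdist x z + r)).+1 => // y Ay.
apply: le_lt_trans (truncnS_gt _).
by apply: le_trans (metric_triangle _ z _) _; rewrite lerD2l Ar.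
Qed.

End bounded_sets.

Section infdist_approximation.
Context {R : realType} {X : metricType R}.
Implicit Types (A B : CL X) (x : X) (r e : R).

Lemma infdist_lt A x r :
  infdist x A < r -> exists2 y, CL_set A y & mdist x y < r.
Proof.
move=> Ar; have [|_ [y Ay <-] xy] := inf_lt _ Ar; last by exists y.
by have [y Ay] := CL_nonempty A; exists (mdist x y), y.
Qed.

(** Only points nearly attaining the infimum matter, and [infdist x A < r] lets them be taken within
    [r] of [x]. So it suffices to match points of [A] in that ball. *)
Lemma infdist_le_approx A B x r e : infdist x A < r ->
  (forall y, CL_set A y -> mdist x y < r ->
    exists2 z, CL_set B z & mdist y z < e) ->
  infdist x B <= infdist x A + e.
Proof.
move=> Ar AB; apply/ler_addgt0Pr => eta eta0.
have /infdist_lt[y Ay] : infdist x A < Num.min r (infdist x A + eta).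
  by rewrite lt_min Ar ltrDl.
rewrite lt_min => /andP[yr xy]; have [z Bz yz] := AB y Ay yr.
apply: le_trans (infdist_le x Bz) _.
apply: le_trans (metric_triangle _ y _) _.
by rewrite addrAC lerD ?ltW.
Qed.

End infdist_approximation.

Section Attouch_Wets_balls.
Context {R : realType} {X : metricType R}.
Variable x0 : X.
Implicit Types (A B : CL X) (x : X) (n : nat) (e : R).

(** Terms of index at least [n] are capped by [n%:R^-1]; the others are suprema over balls inside
    the [n]-ball. *)
Lemma dAW_le A B n e : (0 < n)%N -> n%:R^-1 <= e ->
  (forall x, mdist x0 x < n%:R -> `|infdist x A - infdist x B| <= e) ->
  dAW x0 A B <= e.
Proof.
move=> n0 ne AB; apply: ge_sup; first by eexists; exists 1%N.
move=> _ [j /= j0 <-]; rewrite ge_min; have [nj|jn] := leqP n j.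
  by rewrite (le_trans _ ne)// lef_pV2 ?posrE ?ltr0n// ler_nat.
apply/orP; right; apply: ge_sup.
  by eexists; exists x0 => //=; rewrite mdistxx ltr0n.
move=> _ [x /= xj <-]; apply: AB.
by rewrite (lt_trans xj)// ltr_nat.
Qed.

(** A distance below [n%:R^-1] rules out the cap as the minimum in the [n]-th term, so it dominates
    the supremum over the [n]-ball. *)
Lemma infdist_gap_lt A B n e x : (0 < n)%N ->
  dAW x0 A B < Num.min n%:R^-1 e -> mdist x0 x < n%:R ->
  `|infdist x A - infdist x B| < e.
Proof.
rewrite lt_min => n0 /andP[ABn ABe] xn.
set t : R := sup [set `|infdist y A - infdist y B| |
                   y in [set y | mdist x0 y < n%:R]].
have gap_le : `|infdist x A - infdist x B| <= t.
  apply: ub_le_sup; last by exists x.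
  (* [sup] defaults to 0 on unbounded sets, so the gaps must be bounded first. *)
  exists (n%:R + infdist x0 A + (n%:R + infdist x0 B)) => _ [y /= yn <-].
  have le_inf C : infdist y (CL_set C) <= n%:R + infdist x0 C.
    by apply: le_trans (infdist_lip C y x0) _; rewrite lerD2r metric_sym ltW.
  apply: le_trans (ler_normB _ _) _.
  by rewrite !ger0_norm ?infdist_ge0 // lerD.
have : Num.min n%:R^-1 t <= dAW x0 A B.
  apply: ub_le_sup; last by exists n.
  exists 1 => _ [j /= j0 <-].
  by rewrite ge_min invf_le1 ?ltr0n // ler1n j0.
rewrite ge_min => /orP[nAB|tAB]; first by move: (lt_le_trans ABn nAB); rewrite ltxx.
exact: le_lt_trans gap_le (le_lt_trans tAB ABe).
Qed.

Lemma infdist_close A B n e x : (0 < n)%N ->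
  dAW x0 A B < Num.min n%:R^-1 e -> mdist x0 x < n%:R -> CL_set A x ->
  exists2 y, CL_set B y & mdist x y < e.
Proof.
move=> n0 AB xn Ax; apply: infdist_lt.
have := infdist_gap_lt n0 AB xn.
by rewrite (infdist_mem Ax) sub0r normrN ger0_norm ?infdist_ge0.
Qed.

End Attouch_Wets_balls.

Section bounded_convergence_nbhs.
Context {R : realType} {G : topologicalGroupType} {X : metricType R}.
Variable a : continuous_action G X.

Lemma act_invK g : cancel (a g) (a g^-1%g).
Proof. by move=> x; rewrite -actM mulVg act1. Qed.

Lemma nbhs_ucb_set (A : set X) (g : G) (e : R) :
  (forall U : set G, @open (ucb_space a) U -> @open G U) ->
  mbounded A -> 0 < e -> nbhs g (ucb_set a A g e).
Proof.
move=> ucbG bA e0; apply: open_nbhs_nbhs; split; last first.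
  by move=> x _ /=; rewrite mdistxx.
apply: ucbG; exists [set ucb_set a A g e]; last by rewrite bigcup_set1.
move=> _ ->; apply: finI_from1; by exists A, g, e.
Qed.

End bounded_convergence_nbhs.

Theorem theorem4p9 (R : realType) (G : topologicalGroupType) (X : metricType R)
    (a : continuous_action G X)
    (h1 : forall g : G,
      boundedness_preserving (a g) /\ unif_continuous_on_bounded (a g))
    (h2 : forall U : set G, @open (ucb_space a) U -> @open G U)
    (x0 : X) :
  continuous (fun p : G * CL_AW x0 => CL_act a p.1 p.2 : CL_AW x0).
Proof.
move=> [g0 A]; apply/cvg_ballP => e' e'0.
(* [dAW_le] gives a non-strict bound; halving makes the final one strict. *)
pose e : R := e' / 2; have e0 : 0 < e by rewrite divr_gt0.
pose J := (Num.truncn e^-1).+1.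
have Je : J%:R^-1 <= e.
  by rewrite invf_ple ?posrE ?ltr0n// ltW// truncnS_gt.
pose C := CL_act a g0 A; pose r := infdist x0 C.
(* [J + r + e] bounds the distance from a point of the [J]-ball to [g B], so [M]
   bounds the distance from [x0] to the points of [g B] that nearly attain it. *)
pose M : R := J%:R + (J%:R + r + e).
pose K1 := [set y | mdist x0 y < M].
(* The first margin 1 absorbs the error of [g^-1] against [g0^-1] on [K1]; the second makes room for
   the partners of points of [K]. *)
pose K := thickening (a g0^-1%g @` K1) 1; pose K' := thickening K 1.
have bK1 : mbounded K1 by exact: mbounded_ball.
have bK : mbounded K by apply: mbounded_thickening; apply: (h1 _).1.
have bK' : mbounded K' by exact: mbounded_thickening.
have KK' : K `<=` K' by move=> y Ky; exists y; rewrite // mdistxx.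
have [n n0 K'n] := mbounded_sub_ball x0 bK'.
have e20 : 0 < e / 2 by rewrite divr_gt0.
have [d d0 ucd] := (h1 g0).2 K bK _ e20.
(* [n%:R^-1] makes the [n]-ball, which contains [K'], visible to [dAW]; [d] serves the uniform
   continuity of [g0]; 1 keeps partners of points of [K] inside [K']. *)
pose d1 := Num.min n%:R^-1 (Num.min d 1).
have d10 : 0 < d1 by rewrite !lt_min invr_gt0 ltr0n n0 d0 ltr01.
have nearg : \forall g \near g0,
    ucb_set a K' g0 (e / 2) g /\ ucb_set a K1 g0^-1%g 1 g^-1%g.
  apply: filterI; first exact: nbhs_ucb_set.
  exact: (@invg_continuous G g0 _ (nbhs_ucb_set g0^-1%g h2 bK1 ltr01)).
exists ([set g | ucb_set a K' g0 (e / 2) g /\ ucb_set a K1 g0^-1%g 1 g^-1%g],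
        ball (A : CL_AW x0) d1); first by split=> //; exact: nbhsx_ballx.
move=> [g B] [[/= gK' gK1]]; rewrite !ballEmdist /= => AB.
have AB' : dAW x0 A B < Num.min n%:R^-1 (Num.min d 1) by [].
have BA' : dAW x0 B A < Num.min n%:R^-1 (Num.min d 1) by rewrite dAW_sym.
have forth y : CL_set C y -> mdist x0 y < M ->
    exists2 z, CL_set (CL_act a g B) z & mdist y z < e.
  move=> [u Au <-{y}] yM.
  have Ku : K u.
    by exists u; rewrite ?mdistxx //; exists (a g0 u); rewrite ?act_invK.
  have [v Bv] := infdist_close n0 AB' (K'n _ (KK' _ Ku)) Au.
  rewrite lt_min => /andP[uvd uv1]; exists (a g v); first by exists v.
  have K'v : K' v by exists u.
  apply: le_lt_trans (metric_triangle _ (a g0 v) _) _.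
  by rewrite [e]splitr ltrD ?gK' // ucd.
have back y : CL_set (CL_act a g B) y -> mdist x0 y < M ->
    exists2 z, CL_set C z & mdist y z < e.
  move=> [v Bv <-{y}] yM.
  have Kv : K v.
    (* Here [v] is the image of [a g v] under [g^-1], hence within 1 of its image under [g0^-1]. *)
    exists (a g0^-1%g (a g v)); first by exists (a g v).
    by rewrite -{2}(act_invK a g v); apply: gK1.
  have [u Au] := infdist_close n0 BA' (K'n _ (KK' _ Kv)) Bv.
  rewrite lt_min => /andP[uvd _]; exists (a g0 u); first by exists u.
  apply: le_lt_trans (metric_triangle _ (a g0 v) _) _.
  rewrite [e]splitr ltrD ?ucd // metric_sym.
  by apply: gK'; exact: KK'.
have J0 : 0 < J%:R :> R by rewrite ltr0n.
have ball_sub x s y : mdist x0 x < J%:R -> s <= J%:R + r + e ->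
    mdist x y < s -> mdist x0 y < M.
  move=> xJ sM xy; apply: le_lt_trans (metric_triangle _ x _) _.
  by rewrite ltrD // (lt_le_trans xy).
have leC x : mdist x0 x < J%:R ->
    infdist x (CL_act a g B) <= infdist x C + e.
  move=> xJ; apply: (@infdist_le_approx _ _ _ _ _ (J%:R + r)) => [|y Cy xy].
    apply: le_lt_trans (infdist_lip C x x0) _.
    by rewrite metric_sym ltrD2r.
  by apply: forth => //; apply: (ball_sub x _ y xJ _ xy); rewrite lerDl ltW.
have leD x : mdist x0 x < J%:R ->
    infdist x C <= infdist x (CL_act a g B) + e.
  move=> xJ.
  apply: (@infdist_le_approx _ _ _ _ _ (J%:R + r + e)) => [|y Dy xy].
    apply: le_lt_trans (infdist_lip (CL_act a g B) x x0) _.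
    (* [leC] at [x0] itself bounds [infdist x0] of [g B] by [r + e], whence the larger radius
       here. *)
    rewrite metric_sym -addrA ltr_leD // leC // mdistxx.
    exact: J0.
  by apply: back => //; exact: (ball_sub x _ y xJ _ xy).
apply: (@le_lt_trans _ _ e); last by rewrite /e; lra.
apply: (@dAW_le _ _ _ C (CL_act a g B) J) => // x xJ.
by rewrite ler_distl lerBlDr leC // leD.
Qed.
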